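(* The quasi-orders $\preccurlyeq_2^s$ and $\preccurlyeq_2^p$ on $\mathcal P(M_2)$ are Borel bireducible: $\preccurlyeq_2^s\leq_B\preccurlyeq_2^p$ and $\preccurlyeq_2^p\leq_B\preccurlyeq_2^s$.
   Context: $M_2$ is the free monoid on generators $a,b$, and $\mathcal P(M_2)$ is identified with $2^{M_2}$. For $A,B\subseteq M_2$: $A\preccurlyeq_2^s B$ iff there is $m\in M_2$ with $Am=B\cap M_2m$; and $A\preccurlyeq_2^p B$ iff there is $m\in M_2$ with $mA=B\cap mM_2$. $Q\leq_B Q'$ means there is a Borel map $f$ with $x\mathbin{Q}y\Leftrightarrow f(x)\mathbin{Q'}f(y)$. *)

(* Defs.v *)
From HB Require Import structures.
From mathcomp Require Import all_boot.
From mathcomp Require Import boolp classical_sets topology measure.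

Set Implicit Arguments.
Unset Strict Implicit.
Unset Printing Implicit Defensive.

Local Open Scope classical_set_scope.

(* The free monoid on two generators: words over a two-letter alphabet, with
   concatenation [++] as product and [::] as unit. *)
Definition M2 : Type := seq bool.

(* 2^M2 with the product topology of the discrete topology on bool. *)
Definition PM2 : Type := prod_topology (fun _ : M2 => bool).

HB.instance Definition _ := Pointed.on PM2.
HB.instance Definition _ := Nbhs.on PM2.
HB.instance Definition _ := Topological.on PM2.

Definition subset_of (A : PM2) : set M2 := [set w | A w].

Definition rtranslate (X : set M2) (m : M2) : set M2 := [set x ++ m | x in X].

Definition ltranslate (m : M2) (X : set M2) : set M2 := [set m ++ x | x in X].

Definition suffix_le (A B : PM2) : Prop :=
  exists m : M2,
    rtranslate (subset_of A) m = subset_of B `&` rtranslate [set: M2] m.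

Definition prefix_le (A B : PM2) : Prop :=
  exists m : M2,
    ltranslate m (subset_of A) = subset_of B `&` ltranslate m [set: M2].

Definition borel_map (X Y : ptopologicalType) (f : X -> Y) : Prop :=
  measurable_fun [set: g_sigma_algebraType (@open X)]
    (f : g_sigma_algebraType (@open X) -> g_sigma_algebraType (@open Y)).

Definition borel_reducible (X Y : ptopologicalType)
    (Q : X -> X -> Prop) (Q' : Y -> Y -> Prop) : Prop :=
  exists2 f : X -> Y, borel_map f & forall x y, Q x y <-> Q' (f x) (f y).

(* Main.v *)
Require Import Defs.
From mathcomp Require Import all_boot boolp classical_sets topology measure.

(** Word reversal is an anti-automorphism of the free monoid, so reindexing
    subsets along it exchanges left and right translates; being a permutation of
    coordinates, this reindexing is continuous. The same map therefore reduces
    each quasi-order to the other. *)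

Set Implicit Arguments.
Unset Strict Implicit.
Unset Printing Implicit Defensive.

Local Open Scope classical_set_scope.

(** Measurability need only be checked on the open sets generating the target sigma-algebra, and
    their preimages are open. *)
Lemma continuous_borel_map (X Y : ptopologicalType) (f : X -> Y) :
  continuous f -> borel_map f.
Proof.
move=> /continuousP cf; apply: (@measurability _ _ _ (g_sigma_algebraType (@open Y)) _ _ (@open Y)).
  by [].
move=> _ [B oB <-]; rewrite setTI.
by apply: sub_sigma_algebra; exact: cf.
Qed.

(** The product topology is the supremum of the initial topologies of the projections, and
    coordinate [j] of [A \o s] is just the projection of [A] at [s j]. *)
Lemma reindex_continuous (I : eqType) (J : Type) (T : topologicalType) (s : J -> I) :
  continuous ((fun A => A \o s) : prod_topology (fun _ : I => T) ->
                                  prod_topology (fun _ : J => T)).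
Proof.
move=> A; apply/cvg_sup => [|j]; first exact/fmap_filter/nbhs_filter.
apply: continuous_comp_initial.
exact: (@proj_continuous I (fun _ => T) (s j)).
Qed.

Definition rev_set (A : PM2) : PM2 := A \o rev.

Lemma rev_set_borel : borel_map rev_set.
Proof.
apply: continuous_borel_map.
exact: (@reindex_continuous (seq bool) (seq bool) bool rev).
Qed.

Lemma rev_setK : involutive rev_set.
Proof. by move=> A; apply: funext => w; rewrite /rev_set /= revK. Qed.

Lemma cat_injl (T : eqType) (s : seq T) : injective (cat^~ s).
Proof.
(* [eqseq_cat] needs left factors of equal length, so lengths are cancelled first. *)
move=> x y xyE; have sz_xy : size x = size y.
  by apply: (@addIn (size s)); rewrite -!size_cat xyE.
by move/eqP: xyE; rewrite eqseq_cat // eqxx andbT => /eqP.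
Qed.

(** Since right translation by [m] is injective, the set equation amounts to [A] being the pullback
    of [B] along it. *)
Lemma suffix_leP (A B : PM2) :
  suffix_le A B <-> exists m, forall x, A x = B (x ++ m).
Proof.
split=> -[m Hm]; exists m.
  move=> x; apply/idP/idP => h.
    have : rtranslate (subset_of A) m (x ++ m) by exists x.
    by rewrite Hm => -[].
  have : (subset_of B `&` rtranslate setT m) (x ++ m) by split=> //; exists x.
  by rewrite -Hm => -[y Ay yxE]; rewrite -(cat_injl yxE).
apply/seteqP; split=> [_ [x Ax <-]|w [Bx [x _ xE]]].
  by split; [rewrite /subset_of /= -Hm|exists x].
by move: Bx; rewrite -xE /subset_of /= -Hm => Ax; exists x.
Qed.

Lemma prefix_leP (A B : PM2) :
  prefix_le A B <-> exists m, forall x, A x = B (m ++ x).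
Proof.
split=> -[m Hm]; exists m.
  move=> x; apply/idP/idP => h.
    have : ltranslate m (subset_of A) (m ++ x) by exists x.
    by rewrite Hm => -[].
  have : (subset_of B `&` ltranslate m setT) (m ++ x) by split=> //; exists x.
  by rewrite -Hm => -[y Ay /eqP]; rewrite eqseq_cat // eqxx => /eqP <-.
apply/seteqP; split=> [_ [x Ax <-]|w [Bx [x _ xE]]].
  by split; [rewrite /subset_of /= -Hm|exists x].
by move: Bx; rewrite -xE /subset_of /= -Hm => Ax; exists x.
Qed.

(** As [rev (x ++ m) = rev m ++ rev x], a witness [m] on either side yields the witness [rev m] on
    the other. *)
Lemma suffix_le_rev (A B : PM2) :
  suffix_le A B <-> prefix_le (rev_set A) (rev_set B).
Proof.
split=> [/suffix_leP|/prefix_leP] [m Hm].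
  by apply/prefix_leP; exists (rev m) => x; rewrite /rev_set /= rev_cat revK.
apply/suffix_leP; exists (rev m) => x.
by have := Hm (rev x); rewrite /rev_set /= rev_cat !revK.
Qed.

Theorem theorem3p4 :
  borel_reducible suffix_le prefix_le /\ borel_reducible prefix_le suffix_le.
Proof.
split; exists rev_set; first exact: rev_set_borel.
- exact: suffix_le_rev.
- exact: rev_set_borel.
(* The previous equivalence is applied to the reversed sets, whose double reversals cancel. *)
- by move=> A B; rewrite suffix_le_rev !rev_setK.
Qed.
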